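(* Let $n\ge 2$ and $\boldsymbol\mu\in\mathcal M^n$ with $\mu_1>\mu_2\ge\dots\ge\mu_n$, and fix $\alpha\in(1,e/2]$. Run Tri-BBAI with $\epsilon=\frac{1}{\log\log(1/\delta)}$, $L_1=\sqrt{\log(1/\delta)}$, $L_2=\frac{\log(1/\delta)\log\log(1/\delta)}{n}$, $L_3=(\log(1/\delta))^2$, and $\beta(t,\delta)=\log\!\big(\log(1/\delta)\,t^{\alpha}/\delta\big)$. Then there exists $\delta_0\in(0,1)$ such that for all $\delta\in(0,\delta_0)$, the probability that the arm output by the algorithm differs from arm $1$ is at most $\delta$.
   Context: Bandit model. Fix a one-parameter canonical exponential family $\{\nu_\theta\}_{\theta\in\Theta}$ ($\Theta$ an open interval): $\frac{d\nu_\theta}{d\rho}(x)=\exp(x\theta-b(\theta))$ for a reference measure $\rho$ on $\mathbb R$, with $b(\theta)=\log\int e^{x\theta}d\rho(x)$. The mean map $\theta\mapsto b'(\theta)$ is a bijection from $\Theta$ onto an open interval $\mathcal M$, so members of the family are indexed by their mean. For $\mu,\mu'\in\mathcal M$, $d(\mu,\mu')$ denotes the Kullback–Leibler divergence from the member with mean $\mu$ to the member with mean $\mu'$. An instance is $\boldsymbol\mu\in\mathcal M^n$; pulling arm $i$ yields a fresh independent sample from the member with mean $\mu_i$. All logarithms are natural. Characteristic time. For $\boldsymbol\lambda\in\mathcal M^n$ and an index $k$ with $\lambda_k>\lambda_j$ for all $j\ne k$, let $\mathrm{Alt}_k(\boldsymbol\lambda)=\{\boldsymbol\lambda'\in\mathcal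 M^n:\lambda'_j>\lambda'_k\text{ for some }j\neq k\}$, $\mathcal P_n$ the probability simplex in $\mathbb R^n$, and $T^*(\boldsymbol\lambda)^{-1}=\sup_{\mathbf w\in\mathcal P_n}\inf_{\boldsymbol\lambda'\in\mathrm{Alt}_k(\boldsymbol\lambda)}\sum_{i=1}^n w_i\,d(\lambda_i,\lambda'_i)$, with $\mathbf w^*(\boldsymbol\lambda)\in\mathcal P_n$ the (unique) maximizer. Notation during a run. After $t$ total pulls, $N_i(t)$ is the number of pulls of arm $i$, $\hat\mu_i(t)$ the empirical mean of its samples, $i^*(t)\in\arg\max_i\hat\mu_i(t)$ (ties broken by smallest index). For arms $i,j$: $\hat\mu_{ij}(t)=\frac{N_i(t)\hat\mu_i(t)+N_j(t)\hat\mu_j(t)}{N_i(t)+N_j(t)}$; if $\hat\mu_i(t)\ge\hat\mu_j(t)$, $Z_{ij}(t)=N_i(t)\,d(\hat\mu_i(t),\hat\mu_{ij}(t))+N_j(t)\,d(\hat\mu_j(t),\hat\mu_{ij}(t))$, and $Z_j(t)=Z_{i^*(t)j}(t)$. Tri-BBAI algorithm (parameters $\delta,\epsilon,L_1,L_2,L_3,\alpha,\beta$). Stage I (one batch): pull every arm $\lceil L_1\rceil$ times; set $T_i^0=L_1$ for all $i$ and $\mathbf w^*(\mathbf b^0)=(1/n,\dots,1/n)$. Stage II: for $q=1,2,\dots,\lceil\log(1/\delta)\rceil$, with $t$ the current total number of pulls, set $b^q_i=\hat\mu_i(t)+\epsilon$ for $i\ne i^*(t)$ and $b^q_{i^*(t)}=\hat\mu_{i^*(t)}(t)-\epsilon$;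 compute $\mathbf w^*(\mathbf b^q)$ and $T^*(\mathbf b^q)$ with designated index $k=i^*(t)$ (convention: if $\mathbf b^q\notin\mathcal M^n$ or $i^*(t)$ is not the unique maximal coordinate of $\mathbf b^q$, set $\mathbf w^*(\mathbf b^q)$ uniform and $T^*(\mathbf b^q)=+\infty$); let $T_i^q=\min\{\alpha\,w_i^*(\mathbf b^q)T^*(\mathbf b^q)\log(1/\delta),\,L_2\}$; in one batch pull each arm $i$ exactly $\max\{0,\lceil T_i^q\rceil-\lceil\max_{0\le p<q}T_i^p\rceil\}$ times; then if $|w_i^*(\mathbf b^q)-w_i^*(\mathbf b^{q-1})|\le 1/\sqrt n$ for all $i\in[n]$, leave Stage II. Stage III: let $\tau$ be the current total number of pulls; if $\min_{j\ne i^*(\tau)}Z_j(\tau)\ge\beta(\tau,\delta/2)$, stop and output $i^*(\tau)$. Stage IV (one batch, only if Stage III did not stop): pull each arm $i$ an additional $\max\{0,\lceil L_3\rceil-N_i(\tau)\}$ times and output the arm with largest empirical mean. The batch complexity is the number of batches used (Stage I, each executed iteration of Stage II, and Stage IV if executed). *)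

(* Defs.v *)
From HB Require Import structures.
From mathcomp Require Import all_boot all_order all_algebra.
From mathcomp Require Import all_classical all_reals all_analysis.
Set Implicit Arguments. Unset Strict Implicit. Unset Printing Implicit Defensive.
Import Order.TTheory GRing.Theory Num.Theory.
Import numFieldNormedType.Exports.
Local Open Scope classical_set_scope.
Local Open Scope ring_scope.

(* d nu_theta / d rho (x) = exp(x theta - b theta),                     *)

Definition log_partition (R : realType) (rho : {measure set R -> \bar R})
  (th : R) : R := ln (fine (\int[rho]_x (expR (x * th))%:E)%E).

Record expfam (R : realType) := ExpFam {
  ef_rho : {measure set R -> \bar R};
  ef_Theta : set R;
  ef_Theta_open : open ef_Theta;
  ef_Theta_itv : is_interval ef_Theta;
  ef_Theta_nonempty : ef_Theta !=set0;
  ef_mgf_finite : forall th, ef_Theta th ->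
    (\int[ef_rho]_x (expR (x * th))%:E < +oo)%E;
  ef_b_derivable : forall th, ef_Theta th ->
    derivable (log_partition ef_rho) th 1;
  ef_mean_inj : forall th th', ef_Theta th -> ef_Theta th' ->
    derive1 (log_partition ef_rho) th = derive1 (log_partition ef_rho) th' -> th = th';
  ef_M_open : open (derive1 (log_partition ef_rho) @` ef_Theta);
  ef_M_itv : is_interval (derive1 (log_partition ef_rho) @` ef_Theta)
}.

Definition ef_b (R : realType) (F : expfam R) : R -> R :=
  log_partition (ef_rho F).

Definition ef_M (R : realType) (F : expfam R) : set R :=
  (derive1 (ef_b F)) @` ef_Theta F.

(* natural parameter of the member with mean mu (junk 0 if mu \notin M) *)
Definition theta_of (R : realType) (F : expfam R) (mu : R) : R :=
  match pselect (exists th, ef_Theta F th /\ derive1 (ef_b F) th = mu) with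
  | left h => projT1 (cid h)
  | right _ => 0
  end.

Definition ef_dens (R : realType) (F : expfam R) (mu x : R) : R :=
  expR (x * theta_of F mu - ef_b F (theta_of F mu)).

(* Kullback-Leibler divergence KL(nu_mu || nu_mu') = \int p log(p/q) d rho,
   for mu, mu' in M (convention: 0 otherwise) *)
Definition kl (R : realType) (F : expfam R) (mu mu' : R) : R :=
  if `[< ef_M F mu /\ ef_M F mu' >] then
    fine (\int[ef_rho F]_x
      (ef_dens F mu x * ln (ef_dens F mu x / ef_dens F mu' x))%:E)%E
  else 0.

Definition simplex (R : realType) (n : nat) (w : 'I_n -> R) : Prop :=
  (forall i, 0 <= w i) /\ \sum_i w i = 1.

Definition uniformw (R : realType) (n : nat) : 'I_n -> R :=
  fun _ => n%:R^-1.

Definition Alt (R : realType) (F : expfam R) (n : nat) (k : 'I_n)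
  : set ('I_n -> R) :=
  [set l' | (forall i, ef_M F (l' i)) /\ exists j, j != k /\ l' k < l' j].

Definition alt_value (R : realType) (F : expfam R) (n : nat)
  (lam : 'I_n -> R) (k : 'I_n) (w : 'I_n -> R) : R :=
  inf [set (\sum_i w i * kl F (lam i) (l' i)) | l' in Alt F k].

Definition Tstar_inv (R : realType) (F : expfam R) (n : nat)
  (lam : 'I_n -> R) (k : 'I_n) : R :=
  sup [set alt_value F lam k w | w in @simplex R n].

Definition Tstar (R : realType) (F : expfam R) (n : nat)
  (lam : 'I_n -> R) (k : 'I_n) : R := (Tstar_inv F lam k)^-1.

(* w^*(lambda): the (unique) maximizer *)
Definition wstar (R : realType) (F : expfam R) (n : nat)
  (lam : 'I_n -> R) (k : 'I_n) : 'I_n -> R :=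
  match pselect (exists w, simplex w /\ alt_value F lam k w = Tstar_inv F lam k) with
  | left h => projT1 (cid h)
  | right _ => @uniformw R n
  end.

(* Statistics during a run. X i k = (k+1)-th sample of arm i;          *)
(* N i = number of pulls of arm i.                                      *)

Definition emp_mean (R : realType) (n : nat) (X : 'I_n -> nat -> R)
  (N : 'I_n -> nat) (i : 'I_n) : R :=
  (\sum_(k < N i) X i k) / (N i)%:R.

(* index of the largest empirical mean, ties broken by smallest index;
   [one] is only a default value (never used when n > 0) *)
Definition best (n : nat) (one : 'I_n) (R : realType) (m : 'I_n -> R) : 'I_n :=
  odflt one [pick i | [forall j, m j <= m i] &&
                      [forall j, (val j < val i)%N ==> (m j < m i)]].

Definition Zij (R : realType) (F : expfam R) (n : nat) (X : 'I_n -> nat -> R)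
  (N : 'I_n -> nat) (i j : 'I_n) : R :=
  let mi := emp_mean X N i in
  let mj := emp_mean X N j in
  let mij := ((N i)%:R * mi + (N j)%:R * mj) / ((N i)%:R + (N j)%:R) in
  (N i)%:R * kl F mi mij + (N j)%:R * kl F mj mij.

Definition natceil (R : realType) (x : R) : nat := absz (Num.max 0%Z (Num.ceil x)).

Record tri_state (R : realType) (n : nat) := TriState {
  ts_N : 'I_n -> nat;
  ts_maxT : 'I_n -> R;         (* max_{0<=p<q} T_i^p *)
  ts_wprev : 'I_n -> R;
  ts_done : bool
}.

Definition stage2_step (R : realType) (F : expfam R) (n : nat) (one : 'I_n)
  (delta eps L2 alpha : R) (X : 'I_n -> nat -> R) (s : tri_state R n)
  : tri_state R n :=
  if ts_done s then s else
  let N := ts_N s in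
  let m := emp_mean X N in
  let k := best one m in
  let b := fun i => if i == k then m i - eps else m i + eps in
  let valid := `[< (forall i, ef_M F (b i)) /\ (forall j, j != k -> b j < b k) >] in
  let w := if valid then wstar F b k else @uniformw R n in
  let Tq := fun i => if valid
                     then Num.min (alpha * w i * Tstar F b k * ln delta^-1) L2
                     else L2 in
  let N' := fun i => (N i + absz (Num.max 0%Z (Num.ceil (Tq i) - Num.ceil (ts_maxT s i))%R))%N in
  let maxT' := fun i => Num.max (ts_maxT s i) (Tq i) in
  let stop := `[< forall i, `|w i - ts_wprev s i| <= (Num.sqrt n%:R)^-1 >] in
  TriState N' maxT' w stop.

Definition tri_bbai (R : realType) (F : expfam R) (n : nat) (one : 'I_n)
  (delta eps L1 L2 L3 alpha : R) (beta : nat -> R -> R)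
  (X : 'I_n -> nat -> R) : 'I_n :=
  let s0 := TriState (fun _ => natceil L1) (fun _ => L1) (@uniformw R n) false in
  let s := iter (natceil (ln delta^-1)) (stage2_step F one delta eps L2 alpha X) s0 in
  let N := ts_N s in
  let tau := (\sum_i N i)%N in
  let k := best one (emp_mean X N) in
  if `[< forall j, j != k -> beta tau (delta / 2) <= Zij F X N k j >] then k
  else
  let N4 := fun i => maxn (N i) (natceil L3) in
  best one (emp_mean X N4).

Definition mutually_independent (R : realType) (d : measure_display)
  (T : measurableType d) (P : probability T R) (I : eqType)
  (Y : I -> T -> R) : Prop :=
  forall (s : seq I) (A : I -> set R), uniq s ->
    (forall j, measurable (A j)) ->
    P (\bigcap_(j in [set` s]) (Y j @^-1` A j)) =
    (\prod_(j <- s) P (Y j @^-1` A j))%E.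

(* Main.v *)
Require Import Defs.
From HB Require Import structures.
From mathcomp Require Import all_boot all_order all_algebra.
From mathcomp Require Import all_classical all_reals all_analysis.
From mathcomp Require Import measurable_realfun ring lra.
Import Order.TTheory GRing.Theory Num.Theory.
Import numFieldNormedType.Exports.
Local Open Scope classical_set_scope.
Local Open Scope ring_scope.

(** Every [N_i] stays between [L1] and [max L1 L2] whatever the allocation
weights are, and the Stage IV sample sizes are the constant [L3]; so a union
bound over deterministic sample sizes suffices. If arm [k] beats arm 1 at
Stage III, the log-likelihood ratios of arms 1 and [k] against their true
parameters add up to at least [Z_k1 + L1 * C], where
[C = b(th_1) + b(th_k) - 2 b((th_1 + th_k) / 2) > 0] by strict convexity (the
Pythagorean identity for the pooled mean). By a Chernoff bound such an event
has probability about [delta * exp (- C * sqrt (log (1/delta)))], and the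
second factor absorbs the polylogarithmic size of the union. At Stage IV,
tilting both arms to the midpoint bounds the error by
[exp (- C * (log (1/delta))^2)]. *)

Set Implicit Arguments.
Unset Strict Implicit.

(** * Integration *)

Import HBNNSimple.

Lemma cvg_ge0_integral_EFin d (T : measurableType d) (R : realType)
    (mu : {measure set T -> \bar R}) (h : nat -> T -> R) (f : T -> R) :
  (forall n, measurable_fun setT (h n)) -> (forall n x, 0 <= h n x) ->
  (forall x, nondecreasing_seq (h ^~ x)) ->
  (forall x, (h n x)%:E @[n --> \oo] --> (f x)%:E) ->
  (\int[mu]_x (h n x)%:E)%E @[n --> \oo] --> (\int[mu]_x (f x)%:E)%E.
Proof.
move=> mh h0 hnd hf.
have -> : (\int[mu]_x (f x)%:E = \int[mu]_x limn (fun n => (h n x)%:E))%E.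
  by apply: eq_integral => x _; apply/esym/cvg_lim => //; exact: hf.
apply: cvg_monotone_convergence => //.
- by move=> n; exact/measurable_EFinP.
- by move=> n x _; rewrite lee_fin.
- by move=> x _ m n mn; rewrite lee_fin; exact: hnd.
Qed.

(** The hypothesis says that [Y] carries the measure with density [g] to [c * nu]. It passes from
    sets to simple functions by linearity, then to [f] by monotone convergence. One statement serves
    both a change of density and the splitting off of an independent factor. *)
Lemma ge0_integral_comp_density d1 d2 (T1 : measurableType d1)
    (T2 : measurableType d2) (R : realType) (mu : {measure set T1 -> \bar R})
    (nu : {measure set T2 -> \bar R}) (Y : T1 -> T2) (g : T1 -> R) (c : R)
    (f : T2 -> R) :
  measurable_fun setT Y -> measurable_fun setT g -> (forall x, 0 <= g x) ->
  0 <= c ->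
  (forall A, measurable A ->
    (\int[mu]_(x in Y @^-1` A) (g x)%:E = c%:E * nu A)%E) ->
  measurable_fun setT f -> (forall y, 0 <= f y) ->
  (\int[mu]_x (f (Y x) * g x)%:E = c%:E * \int[nu]_y (f y)%:E)%E.
Proof.
move=> mY mg g0 c0 H mf f0.
have mf' : measurable_fun setT (EFin \o f) by apply/measurable_EFinP.
pose h := nnsfun_approx measurableT mf'.
have mh n : measurable_fun setT (h n) by exact: measurable_funP.
have hcvg y : (h n y)%:E @[n --> \oo] --> (f y)%:E.
  by apply: (cvg_nnsfun_approx measurableT mf') => // x _; rewrite lee_fin.
have hnd y : nondecreasing_seq (fun n => h n y).
  by move=> m n mn; exact/lefP/nd_nnsfun_approx.
have mhg n : measurable_fun setT (fun x => h n (Y x) * g x).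
  by apply: measurable_funM => //; exact: measurableT_comp.
have h0 n x : 0 <= h n x by exact: fun_ge0.
have R1 := cvg_ge0_integral_EFin (mu := nu) mh h0 hnd hcvg.
have L1 : (\int[mu]_x (h n (Y x) * g x)%:E)%E @[n --> \oo] -->
    (\int[mu]_x (f (Y x) * g x)%:E)%E.
  apply: (cvg_ge0_integral_EFin (h := fun n x => h n (Y x) * g x)) => //.
  - by move=> n y; rewrite mulr_ge0.
  - by move=> y m n mn; rewrite ler_wpM2r//; exact: hnd.
  - move=> x; rewrite EFinM; under eq_fun do rewrite EFinM.
    by apply: cvgeZr => //; exact: hcvg.
have key n : (\int[mu]_x (h n (Y x) * g x)%:E = c%:E * \int[nu]_y (h n y)%:E)%E.
  have mr r : measurable (h n @^-1` [set r]) by exact: measurable_sfunP.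
  transitivity (\int[mu]_x \sum_(r \in range (h n))
      (r * (\1_(h n @^-1` [set r]) (Y x) * g x))%:E)%E.
    apply: eq_integral => x _; rewrite fsumEFin// [X in (X * _)%:E]fimfunE.
    congr EFin; rewrite !fsbig_finite//= mulr_suml.
    by apply: eq_bigr => r _; rewrite mulrA.
  have mrg r : measurable_fun setT (fun x => \1_(h n @^-1` [set r]) (Y x) * g x).
    apply: measurable_funM => //.
    exact: (measurableT_comp (measurable_indic (mr r)) mY).
  rewrite ge0_integral_fsum//; last 2 first.
  - by move=> r; apply/measurable_EFinP/measurable_funM.
  - move=> r x _; rewrite lee_fin mulrA mulr_ge0//.
    exact: nnfun_muleindic_ge0.
  have -> : (\int[nu]_y (h n y)%:E =
      \sum_(r \in range (h n)) r%:E * nu (h n @^-1` [set r]))%E.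
    by rewrite integralT_nnsfun sintegralE.
  rewrite ge0_mule_fsumr; last first.
    by move=> r; exact: nnsfun_mulemu_ge0.
  apply: eq_fsbigr => r /[!inE] -[y _ hr].
  have r0 : 0 <= r by rewrite -hr.
  under eq_integral do rewrite EFinM.
  rewrite ge0_integralZl//; last 2 first.
  - by apply/measurable_EFinP.
  - by move=> x _; rewrite lee_fin mulr_ge0.
  rewrite muleCA; congr (_ * _)%E; rewrite -H// [RHS]integral_mkcond.
  apply: eq_integral => x _; rewrite patchE indicE.
  have -> : (Y x \in h n @^-1` [set r]) = (x \in Y @^-1` (h n @^-1` [set r])).
    by apply/idP/idP; rewrite !inE.
  by case: ifPn => _ /=; rewrite ?mul1r ?mul0r.
have L2 : (\int[mu]_x (h n (Y x) * g x)%:E)%E @[n --> \oo] -->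
    (c%:E * \int[nu]_y (f y)%:E)%E.
  by under eq_fun do rewrite key; exact: cvgeZl.
exact: (cvg_unique _ L1 L2).
Qed.

Lemma ge0_integral_law d (T : measurableType d) (R : realType)
    (P : {measure set T -> \bar R}) (rho : {measure set R -> \bar R})
    (X : T -> R) (g f : R -> R) :
  measurable_fun setT X -> measurable_fun setT g -> (forall x, 0 <= g x) ->
  (forall A, measurable A ->
    P (X @^-1` A) = (\int[rho]_(x in A) (g x)%:E)%E) ->
  measurable_fun setT f -> (forall y, 0 <= f y) ->
  (\int[P]_w (f (X w))%:E = \int[rho]_x (f x * g x)%:E)%E.
Proof.
move=> mX mg g0 H mf f0.
pose X' : {mfun T >-> R} := HB.pack X (isMeasurableFun.Build _ _ _ _ _ mX).
rewrite (ge0_integral_comp_density (Y := id) (nu := pushforward P X') (c := 1))//.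
  rewrite mul1e [RHS]ge0_integral_pushforward//; first exact/measurable_EFinP.
  by move=> y _; rewrite lee_fin.
by move=> A mA; rewrite mul1e preimage_id -H.
Qed.

Lemma ge0_integral_prod_indep d (T : measurableType d) (R : realType)
    (P : probability T R) (I : eqType) (Y : I -> T -> R) (f : I -> R -> R)
    (v : I -> R) (s : seq I) :
  (forall j, measurable_fun setT (Y j)) -> mutually_independent P Y ->
  (forall j, measurable_fun setT (f j)) -> (forall j y, 0 <= f j y) ->
  (forall j, (\int[P]_w (f j (Y j w))%:E = (v j)%:E)%E) -> uniq s ->
  (\int[P]_w (\prod_(j <- s) f j (Y j w))%:E = (\prod_(j <- s) v j)%:E)%E.
Proof.
move=> mY indep mf f0 fv us.
have v0 j : 0 <= v j.
  by rewrite -lee_fin -fv integral_ge0// => x _; rewrite lee_fin.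
have mfY j : measurable_fun setT (fun w => f j (Y j w)).
  exact: measurableT_comp.
have mYA j A : measurable A -> measurable (Y j @^-1` A).
  by move=> mA; rewrite -[_ @^-1` _]setTI; exact: mY.
have mB (r : seq I) (A : I -> set R) : (forall j, measurable (A j)) ->
    measurable (\bigcap_(j in [set` r]) (Y j @^-1` A j)).
  by move=> mA; apply: fin_bigcap_measurable => // j _; exact: mYA.
(* Generalised for induction: indices in [s1] still carry functions, those in [s2] carry events.
   Each step tests the head function of [s1] against sets, which moves its index into [s2]. *)
suff main (s1 s2 : seq I) (A : I -> set R) : uniq (s1 ++ s2) ->
    (forall j, measurable (A j)) ->
    (\int[P]_(w in \bigcap_(j in [set` s2]) (Y j @^-1` A j))
      (\prod_(j <- s1) f j (Y j w))%:E =
    (\prod_(j <- s1) v j * \prod_(j <- s2) fine (P (Y j @^-1` A j)))%:E)%E.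
  have := main s [::] (fun=> setT); rewrite cats0 => /(_ us (fun=> measurableT)).
  by rewrite big_nil mulr1 set_nil bigcap_set0.
elim: s1 s2 A => [|j s1 IH] s2 A us12 mA.
  under eq_integral do rewrite big_nil.
  rewrite big_nil mul1r integral_cst//; last exact: mB.
  rewrite mul1e; apply: (etrans (indep s2 A us12 mA)).
  rewrite -prodEFin; apply: eq_bigr => i _.
  by rewrite fineK// fin_num_measure//; exact: mYA.
set B := \bigcap_(_ in _) _.
have mBB : measurable B by exact: mB.
pose g w := \1_B w * \prod_(i <- s1) f i (Y i w).
pose c := \prod_(i <- s1) v i * \prod_(i <- s2) fine (P (Y i @^-1` A i)).
pose X' : {mfun T >-> R} :=
  HB.pack (Y j) (isMeasurableFun.Build _ _ _ _ _ (mY j)).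
transitivity (\int[P]_w (f j (Y j w) * g w)%:E)%E.
  rewrite integral_mkcond; apply: eq_integral => w _.
  rewrite patchE /g indicE big_cons.
  by case: ifPn => _ /=; rewrite ?mul1r ?mul0r ?mulr0.
rewrite (ge0_integral_comp_density (nu := pushforward P X') (c := c))//.
- rewrite [X in (_ * X)%E]ge0_integral_pushforward//; last 2 first.
  + exact/measurable_EFinP.
  + by move=> y _; rewrite lee_fin.
  by rewrite /= fv -EFinM /c big_cons -mulrA mulrC.
- apply: measurable_funM; first exact: measurable_indic.
  by apply: measurable_prod => i _.
- by move=> w; rewrite mulr_ge0// prodr_ge0.
- by rewrite mulr_ge0// prodr_ge0// => i _; rewrite fine_ge0.
move=> A' mA'.
pose A2 i := if i == j then A' else A i.
have js2 : j \notin s2.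
  by move: us12; rewrite /= mem_cat negb_or => /andP[/andP[]].
have A2E i : i \in s2 -> A2 i = A i.
  by rewrite /A2 => is2; case: eqP => // ij; rewrite -ij is2 in js2.
(* The event for [Y j] joins those of [s2], so the induction hypothesis applies to [j :: s2]. *)
transitivity (\int[P]_(w in \bigcap_(i in [set` j :: s2]) (Y i @^-1` A2 i))
    (\prod_(i <- s1) f i (Y i w))%:E)%E.
  rewrite integral_mkcond [RHS]integral_mkcond; apply: eq_integral => w _.
  rewrite !patchE /g indicE.
  have -> : (w \in \bigcap_(i in [set` j :: s2]) (Y i @^-1` A2 i)) =
      (w \in Y j @^-1` A') && (w \in B).
    apply/idP/andP; rewrite !inE.
      move=> h; split; first by have := h j (mem_head _ _); rewrite /A2 eqxx.
      move=> i /= is2; rewrite -(A2E _ is2); apply: h.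
      by rewrite /= inE is2 orbT.
    move=> [h1 h2] i /=; rewrite inE => /predU1P[->|is2].
      by rewrite /A2 eqxx.
    by rewrite A2E//; exact: h2.
  by case: ifPn => //= _; case: ifPn => /= _; rewrite ?mul1r ?mul0r.
rewrite IH; last 2 first.
- by rewrite -cat_rcons -cats1 -catA uniq_catCA.
- by move=> i; rewrite /A2; case: ifP.
rewrite big_cons {1}/A2 eqxx /c mulrCA EFinM muleC.
rewrite fineK; last by rewrite fin_num_measure//; exact: mYA.
congr (_%:E * _)%E; congr (_ * _).
by apply: eq_big_seq => i is2; rewrite A2E.
Qed.

(** * Probabilities of rays and of finite unions *)

(** The ray [V] may be open, closed or the whole line; it is a countable increasing union of closed
    rays with endpoints in [V], and continuity from below carries the bound over. *)
Lemma measure_upclosed_le d (T : measurableType d) (R : realType)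
    (P : probability T R) (B : set T) (S : T -> R) (V : set R) (c : \bar R) :
  measurable B -> measurable_fun setT S -> (0 <= c)%E ->
  (forall t u, V t -> t <= u -> V u) ->
  (forall t, V t -> (P (B `&` [set w | (t <= S w)%R]) <= c)%E) ->
  measurable (B `&` (S @^-1` V)) /\ (P (B `&` (S @^-1` V)) <= c)%E.
Proof.
move=> mB mS c0 up H.
have mSV : measurable (S @^-1` V).
  rewrite -[_ @^-1` _]setTI; apply: mS => //; apply: is_interval_measurable.
  by move=> x y Vx Vy z /andP[xz zy]; exact: up xz.
have mBV : measurable (B `&` (S @^-1` V)) by exact: measurableI.
split => //.
have [->|/set0P[v Vv]] := eqVneq V set0.
  by rewrite preimage_set0 setI0 measure0.
(* The endpoints are constant if [V] has a minimum, [inf V + 1/(p+1)] if it is only bounded below,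
   and [min v (-p)] otherwise. *)
have [t [Vt tnd tV]] : exists t : nat -> R, [/\ forall p, V (t p),
    nonincreasing_seq t & forall x, V x -> exists p, t p <= x].
  have [[m Vm mV]|nomin] := pselect (exists2 m, V m & forall x, V x -> m <= x).
    by exists (fun=> m); split => // x Vx; exists 0%N; exact: mV.
  have [[l lV]|nolb] := pselect (exists l, forall x, V x -> l <= x).
    have hiV : has_inf V by split; [exists v|exists l => x; exact: lV].
    have infV x : V x -> inf V < x.
      move=> Vx; rewrite lt_neqAle inf_lbound ?andbT//; last by case: hiV.
      apply/eqP => xE; apply: nomin; exists x => // y Vy; rewrite -xE.
      by apply: inf_lbound => //; case: hiV.
    exists (fun p => inf V + p.+1%:R^-1); split.
    + move=> p; have [|x Vx xlt] := @inf_adherent _ V p.+1%:R^-1 _ hiV => //.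
      exact: up Vx (ltW xlt).
    + move=> p q pq; rewrite lerD2l lef_pV2 ?posrE// ler_nat.
      by rewrite ltnS.
    + move=> x /infV; rewrite -subr_gt0 => d0.
      exists (Num.truncn (x - inf V)^-1); rewrite -lerBrDl.
      rewrite -[leRHS]invrK lef_pV2 ?posrE ?invr_gt0//.
      by rewrite ltW// truncnS_gt.
  exists (fun p => Num.min v (- p%:R)); split.
  + move=> p; have [x Vx xlt] : exists2 x, V x & x < Num.min v (- p%:R).
      apply: contrapT => nx; apply: nolb; exists (Num.min v (- p%:R)) => x Vx.
      by rewrite leNgt; apply/negP => xlt; apply: nx; exists x.
    exact: up Vx (ltW xlt).
  + by move=> p q pq; rewrite le_min ge_min lexx /= ge_min lerN2 ler_nat pq orbT.
  + move=> x _; exists (Num.truncn (- x)).+1; rewrite ge_min; apply/orP; right.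
    by rewrite lerNl ltW// truncnS_gt.
pose F p := B `&` [set w | t p <= S w].
have mF p : measurable (F p).
  apply: measurableI => //; rewrite (_ : [set _ | _] = S @^-1` `[t p, +oo[%classic).
    by rewrite -[_ @^-1` _]setTI; exact: mS.
  by apply/seteqP; split => w /=; rewrite in_itv/= andbT.
have FE : \bigcup_p F p = B `&` (S @^-1` V).
  apply/seteqP; split => [w [p _ [Bw tS]]|w [Bw Vw]]; first by split => //; exact: up tS.
  by have [p tp] := tV _ Vw; exists p.
have := @nondecreasing_cvg_mu _ _ _ P F mF _ _.
rewrite FE => /(_ mBV) Fcvg.
have FP : P (F p) @[p --> \oo] --> P (B `&` (S @^-1` V)).
  apply: Fcvg => p q pq; apply/subsetPset => w [Bw tS]; split => //=.
  by rewrite (le_trans _ tS)//; exact: tnd.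
rewrite -(cvg_lim _ FP)//; apply: lime_le; first by apply/cvg_ex; eexists; exact: FP.
by apply: nearW => p; exact: H.
Qed.

Lemma measure_bigcup_fin_le d (T : measurableType d) (R : realType)
    (P : probability T R) (J : finType) (G : J -> set T) (c : R) :
  (forall j, measurable (G j) /\ (P (G j) <= c%:E)%E) ->
  measurable (\big[setU/set0]_j G j) /\
  (P (\big[setU/set0]_j G j) <= (c *+ #|J|)%:E)%E.
Proof.
move=> H; split; first by apply: bigsetU_measurable => j _; case: (H j).
suff : measurable (\big[setU/set0]_j G j) /\
    (P (\big[setU/set0]_j G j) <= \sum_j P (G j))%E.
  move=> [_ /le_trans]; apply.
  by rewrite -sumr_const -sumEFin; apply: lee_sum => j _; case: (H j).
apply: (big_ind2 (fun A x => measurable A /\ (P A <= x)%E)).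
- by rewrite measure0.
- move=> A x B y [mA Ax] [mB By]; split; first exact: measurableU.
  by rewrite (le_trans (measureU2 _ mA mB))// leeD.
- by move=> j _; case: (H j).
Qed.

(** * Exponential families *)

(** The density indexed by its natural parameter rather than by its mean. *)
Definition ef_tilt (R : realType) (F : expfam R) (th x : R) : R :=
  expR (x * th - ef_b F th).

(** With [m] the midpoint and [q] the midpoint of [m] and [y], the tangents at [m] and [q] give an
    excess of at least [(y - x) / 4 * (b' q - b' m)]. This product is nonnegative by the two
    tangents between [m] and [q], and nonzero by injectivity of [b']. *)
Lemma mid_lt_tangent (R : realType) (D : set R) (b b' : R -> R) :
  (forall x y, D x -> D y -> D ((x + y) / 2)) ->
  (forall x y, D x -> D y -> b x + (y - x) * b' x <= b y) ->
  (forall x y, D x -> D y -> b' x = b' y -> x = y) ->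
  forall x y, D x -> D y -> x != y -> 2 * b ((x + y) / 2) < b x + b y.
Proof.
move=> mid tan inj x y Dx Dy; set m := (x + y) / 2.
have Dm : D m by exact: mid.
pose q := (m + y) / 2; have Dq : D q by exact: mid.
have t1 := tan _ _ Dm Dx; have t2 := tan _ _ Dm Dq.
have t3 := tan _ _ Dq Dy; have t4 := tan _ _ Dq Dm.
rewrite -subr_eq0 => xy0.
have d0 : b' q - b' m != 0.
  rewrite subr_eq0; apply/eqP => E; have qm := inj _ _ Dq Dm E.
  move/eqP: xy0; apply; clear -qm; rewrite /q /m in qm; lra.
have hd0 : (y - x) * (b' q - b' m) != 0.
  by rewrite mulf_neq0// -oppr_eq0 opprB.
have e1 : q - m = (y - x) / 4 by rewrite /q /m; field.
have e2 : y - q = (y - x) / 4 by rewrite /q /m; field.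
have e3 : x - m = - (2 * ((y - x) / 4)) by rewrite /m; field.
have e4 : m - q = - ((y - x) / 4) by rewrite -e1 opprB.
move: t1 t2 t3 t4 hd0; rewrite e1 e2 e3 e4 neq_lt {e1 e2 e3 e4 d0}.
set h := y - x.
move: h (b x) (b y) (b m) (b q) (b' m) (b' q) => h bx by_ bm bq dm dq t1 t2 t3 t4 hd0.
by case/orP: hd0 => ?; lra.
Qed.

Section expfam_theory.
Variables (R : realType) (F : expfam R).
Local Notation b := (ef_b F).
Local Notation Theta := (ef_Theta F).
Local Notation rho := (ef_rho F).
Local Notation p := (ef_tilt F).

Lemma theta_of_mem (mu : R) : ef_M F mu -> Theta (theta_of F mu).
Proof.
move=> [th Tth thmu]; rewrite /theta_of; case: pselect => [h|[]].
  by case: (cid h) => /= ? [].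
by exists th.
Qed.

Lemma theta_ofK (mu : R) : ef_M F mu -> derive1 b (theta_of F mu) = mu.
Proof.
move=> [th Tth thmu]; rewrite /theta_of; case: pselect => [h|[]].
  by case: (cid h) => /= ? [].
by exists th.
Qed.

Lemma ef_densE (mu : R) : ef_dens F mu = p (theta_of F mu).
Proof. by []. Qed.

Lemma measurable_expR_mul (a c : R) :
  measurable_fun setT (fun x : R => expR (x * a + c)).
Proof.
apply: measurableT_comp => //; apply: measurable_funD => //.
exact: measurable_funM.
Qed.

Lemma measurable_ef_tilt th : measurable_fun setT (p th).
Proof. exact: measurable_expR_mul. Qed.

Lemma Theta_ball th : Theta th -> exists2 e : R, 0 < e &
  forall h, `|h| < e -> Theta (th + h).
Proof.
move=> Tth; have := @ef_Theta_open R F; rewrite openE => /(_ _ Tth).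
move=> [e /= e0 eT]; exists e => // h he; apply: eT.
by rewrite /ball /= opprD addNKr normrN.
Qed.

Lemma Theta_mid th ph : Theta th -> Theta ph -> Theta ((th + ph) / 2).
Proof.
move=> Tt Tp; have [tp|pt] := leP th ph.
  by apply: (ef_Theta_itv Tt Tp); apply/andP; split; lra.
by apply: (ef_Theta_itv Tp Tt); apply/andP; split; lra.
Qed.

Lemma mgf_gt0 th : Theta th -> (0 < \int[rho]_x (expR (x * th))%:E)%E.
Proof.
have m0 t : measurable_fun setT (fun x : R => (expR (x * t))%:E).
  apply/measurable_EFinP; have := measurable_expR_mul t 0.
  by under eq_fun do rewrite addr0.
have abs t : (\int[rho]_x `|(expR (x * t))%:E| = \int[rho]_x (expR (x * t))%:E)%E.
  by apply: eq_integral => x _; rewrite gee0_abs// lee_fin expR_ge0.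
move=> Tth; rewrite lt0e integral_ge0 ?andbT; last first.
  by move=> x _; rewrite lee_fin expR_ge0.
apply/eqP => I0.
have I0' t : (\int[rho]_x (expR (x * t))%:E = 0)%E.
  rewrite -abs; apply/(ae_eq_integral_abs _ measurableT (m0 t)).
  move: I0; rewrite -abs => /(ae_eq_integral_abs _ measurableT (m0 th)).
  apply: filterS => x /(_ I) /eqP; rewrite /= eqe gt_eqF//.
  exact: expR_gt0.
have b0 : log_partition rho = cst 0.
  by apply/funext => t; rewrite /log_partition I0' /= ln0.
have [e e0 eT] := Theta_ball Tth.
have Te : Theta (th + e / 2) by apply: eT; rewrite gtr0_norm; lra.
have := ef_mean_inj Tth Te.
rewrite b0 !derive1_cst => /(_ erefl); lra.
Qed.

Lemma integral_expR th : Theta th ->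
  (\int[rho]_x (expR (x * th))%:E = (expR (b th))%:E)%E.
Proof.
move=> Tth; have I0 := mgf_gt0 Tth; have If := ef_mgf_finite Tth.
have Ifin : (\int[rho]_x (expR (x * th))%:E)%E \is a fin_num.
  by rewrite ge0_fin_numE// ltW.

have -> : b th = ln (fine (\int[rho]_x (expR (x * th))%:E)%E) by [].
by rewrite lnK ?fineK// posrE fine_gt0// I0 If.
Qed.

Lemma integral_tilt_exp th ph : Theta th -> Theta ph ->
  (\int[rho]_x (expR (x * (ph - th)) * p th x)%:E = (expR (b ph - b th))%:E)%E.
Proof.
move=> Tth Tph; rewrite (expRD (b ph) (- b th)) EFinM muleC -(integral_expR Tph).
have mph : measurable_fun setT (fun x : R => (expR (x * ph))%:E).
  apply/measurable_EFinP; have := measurable_expR_mul ph 0.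
  by under eq_fun do rewrite addr0.
rewrite -(ge0_integralZl rho measurableT mph); last 2 first.
- by move=> x _; rewrite lee_fin expR_ge0.
- by rewrite lee_fin expR_ge0.
apply: eq_integral => x _; rewrite /ef_tilt -EFinM -!expRD; congr (expR _)%:E.
by ring.
Qed.

Lemma integrable_tilt th : Theta th -> rho.-integrable setT (EFin \o p th).
Proof.
move=> Tth; apply/integrableP; split.
  by apply/measurable_EFinP; exact: measurable_ef_tilt.
rewrite (eq_integral (fun x : R => (expR (x * (th - th)) * p th x)%:E)).
  by rewrite integral_tilt_exp// ltry.
move=> x _ /=; rewrite subrr mulr0 expR0 mul1r ger0_norm//.
exact: expR_ge0.
Qed.

Lemma integral_tilt th : Theta th -> (\int[rho]_x (p th x)%:E = 1)%E.
Proof.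
move=> Tth; rewrite (eq_integral (fun x : R => (expR (x * (th - th)) * p th x)%:E)).
  by rewrite integral_tilt_exp// subrr expR0.
by move=> x _; rewrite subrr mulr0 expR0 mul1r.
Qed.

Lemma integrable_tilt_exp th ph : Theta th -> Theta ph ->
  rho.-integrable setT (fun x : R => (expR (x * (ph - th)) * p th x)%:E).
Proof.
move=> Tth Tph; apply/integrableP; split.
  apply/measurable_EFinP; apply: measurable_funM; last exact: measurable_ef_tilt.
  have := measurable_expR_mul (ph - th) 0.
  by under eq_fun do rewrite addr0.
rewrite (eq_integral (fun x : R => (expR (x * (ph - th)) * p th x)%:E)).
  by rewrite integral_tilt_exp// ltry.
by move=> x _ /=; rewrite ger0_norm// mulr_ge0// expR_ge0.
Qed.

(** Domination by the tilts at [th + h] and [th - h] with [h = e / 2], since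
    [h * |x| <= exp (h x) + exp (- h x)]. *)
Lemma integrable_id_tilt th : Theta th ->
  rho.-integrable setT (fun x : R => (x * p th x)%:E).
Proof.
move=> Tth; have [e e0 eT] := Theta_ball Tth.
have h0 : 0 < e / 2 by lra.
have T1 : Theta (th + e / 2) by apply: eT; rewrite gtr0_norm; lra.
have T2 : Theta (th - e / 2) by apply: eT; rewrite normrN gtr0_norm; lra.
apply: (@le_integrable _ _ _ rho setT measurableT _
  (fun x : R => (e / 2)^-1%:E * ((expR (x * (th + e / 2 - th)) * p th x)%:E +
             (expR (x * (th - e / 2 - th)) * p th x)%:E))%E); last 2 first.
- move=> x _; rewrite -EFinD -EFinM !abse_EFin lee_fin -mulrDl mulrA.
  rewrite [leLHS]normrM [leRHS]normrM ler_wpM2r//.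
  rewrite !(addrC th) !addrK [leRHS]ger0_norm; last first.
    by rewrite mulr_ge0 ?invr_ge0 ?addr_ge0 ?expR_ge0//; lra.
  rewrite ler_pdivlMl//.
  have H1 := expR_ge1Dx (x * (e / 2)).
  have H2 := expR_ge1Dx (x * - (e / 2)).
  have E1 := expR_ge0 (x * (e / 2)).
  have E2 := expR_ge0 (x * - (e / 2)).
  by case: (ger0P x) => _; nra.
- apply: integrableZl => //; apply: integrableD => //.
    exact: (integrable_tilt_exp Tth T1).
  exact: (integrable_tilt_exp Tth T2).
apply/measurable_EFinP; apply: measurable_funM => //; exact: measurable_ef_tilt.
Qed.

Lemma integral_affine_tilt th (u v : R) : Theta th ->
  (\int[rho]_x ((u * x + v) * p th x)%:E =
   (u * fine (\int[rho]_x (x * p th x)%:E) + v)%:E)%E.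
Proof.
move=> Tth; have i1 := integrable_id_tilt Tth; have i2 := integrable_tilt Tth.
transitivity (\int[rho]_x (u%:E * (x * p th x)%:E + v%:E * (p th x)%:E))%E.
  by apply: eq_integral => x _; rewrite -!EFinM -EFinD; congr EFin; ring.
rewrite integralD//; [|exact: integrableZl..].
rewrite !integralZl// integral_tilt// mule1 EFinD EFinM fineK//.
exact: integrable_fin_num.
Qed.

(* Jensen: [e^y >= e^c (1 + y - c)] with [y = (ph - th) x] and [c] its mean. *)
Lemma log_partition_tangent_mean th ph : Theta th -> Theta ph ->
  b th + (ph - th) * fine (\int[rho]_x (x * p th x)%:E)%E <= b ph.
Proof.
move=> Tth Tph; set M := fine _; pose c := (ph - th) * M.
suff : expR c <= expR (b ph - b th) by rewrite ler_expR lerBrDl.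
suff : ((expR c)%:E <= (expR (b ph - b th))%:E)%E by rewrite lee_fin.
rewrite -(integral_tilt_exp Tth Tph).
have -> : ((expR c)%:E = \int[rho]_x
    ((expR c * (ph - th) * x + expR c * (1 - c)) * p th x)%:E)%E.
  by rewrite integral_affine_tilt// -/M; congr EFin; rewrite /c; ring.
apply: le_integral => //.
- have i1 := integrable_id_tilt Tth; have i2 := integrable_tilt Tth.
  have := integrableD measurableT
    (integrableZl measurableT (expR c * (ph - th)) i1)
    (integrableZl measurableT (expR c * (1 - c)) i2).
  apply: eq_integrable => // x _ /=.
  by rewrite -!EFinM -EFinD; congr EFin; ring.
- exact: integrable_tilt_exp.
move=> x _; rewrite lee_fin ler_wpM2r// ?expR_ge0//.
have -> : x * (ph - th) = c + (x * (ph - th) - c) by ring.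
rewrite expRD.
have := expR_ge1Dx (x * (ph - th) - c); have := expR_ge0 c.
by nra.
Qed.

(** This avoids differentiating under the integral: by the tangent inequality with slope [M], the
    differentiable function [t |-> b t - t * M] is minimal at [th], so its derivative there is 0. *)
Lemma mean_tilt th : Theta th ->
  fine (\int[rho]_x (x * p th x)%:E)%E = derive1 b th.
Proof.
move=> Tth; have [e e0 eT] := Theta_ball Tth.
set M := fine _.
have Tt t : t \in `]th - e, th + e[ -> Theta t.
  rewrite in_itv/= => /andP[t1 t2]; rewrite -[t](subrKC th); apply: eT.
  by rewrite ltr_norml; apply/andP; split; lra.
have dM t : derivable (fun t : R => t * M) t 1 by [].
have db t : t \in `]th - e, th + e[ -> derivable b t 1.
  by move=> /Tt; exact: ef_b_derivable.
have thin : th \in `]th - e, th + e[ by rewrite in_itv/=; apply/andP; split; lra.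
have dD t : t \in `]th - e, th + e[ -> derivable (b - (fun t : R => t * M)) t 1.
  by move=> tI; apply: derivableB; [exact: db|exact: dM].
have minD t : t \in `]th - e, th + e[ ->
    (b - (fun t : R => t * M)) th <= (b - (fun t : R => t * M)) t.
  move=> /Tt Th; have := log_partition_tangent_mean Tth Th.
  rewrite -/M !fctE; move: (b th) (b t) => x y; lra.
have lee : th - e <= th + e by lra.
have : is_derive th 1 (b - (fun t : R => t * M)) 0.
  exact: (derive1_at_min lee dD thin minD).
move=> [_]; rewrite deriveB//; last exact: db.
have dMM : is_derive th 1 (fun t : R => t * M) M.
  by apply: is_derive_eq; rewrite scaler0 add0r /GRing.scale /= mulr1.
rewrite derive1E => /eqP; rewrite subr_eq0 => /eqP ->.
by rewrite derive_val.
Qed.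

Lemma log_partition_tangent th ph : Theta th -> Theta ph ->
  b th + (ph - th) * derive1 b th <= b ph.
Proof.
by move=> Tth Tph; rewrite -mean_tilt//; exact: log_partition_tangent_mean.
Qed.

Lemma log_partition_mid_lt th ph : Theta th -> Theta ph -> th != ph ->
  2 * b ((th + ph) / 2) < b th + b ph.
Proof.
exact: (mid_lt_tangent (fun x y => @Theta_mid x y) log_partition_tangent
  (@ef_mean_inj R F)).
Qed.

(** Adding the tangent inequalities at both parameters shows that the mean is monotone in the
    parameter; equal parameters would have equal means. *)
Lemma theta_of_lt (mu mu' : R) : ef_M F mu -> ef_M F mu' -> mu < mu' ->
  theta_of F mu < theta_of F mu'.
Proof.
move=> Mmu Mmu' lt; have T := theta_of_mem Mmu; have T' := theta_of_mem Mmu'.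
have t1 := log_partition_tangent T T'.
have t2 := log_partition_tangent T' T.
move: t1 t2; rewrite !theta_ofK// => t1 t2.
rewrite lt_neqAle; apply/andP; split; last first.
  move: t1 t2; move: (b (theta_of F mu)) (b (theta_of F mu')) => x y.
  move: (theta_of F mu) (theta_of F mu') => u v *.
  by nra.
by apply/eqP => E; move: lt; rewrite -(theta_ofK Mmu) -(theta_ofK Mmu') E ltxx.
Qed.

(** The log-ratio of two densities is affine in [x], so only the mean of the first member enters. *)
Lemma klE (mu mu' : R) : ef_M F mu -> ef_M F mu' ->
  kl F mu mu' = mu * (theta_of F mu - theta_of F mu') - b (theta_of F mu)
                + b (theta_of F mu').
Proof.
move=> Mmu Mmu'; rewrite /kl asboolT//.
set th := theta_of F mu; set th' := theta_of F mu'.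
have Tth : Theta th := theta_of_mem Mmu.
transitivity (fine (\int[rho]_x
    (((th - th') * x + (b th' - b th)) * p th x)%:E)%E).
  congr fine; apply: eq_integral => x _; congr EFin.
  rewrite /ef_dens -/th -/th' -expRB expRK /ef_tilt mulrC; congr (_ * _).
  by move: (b th) (b th') => y z; ring.
rewrite integral_affine_tilt//= mean_tilt// theta_ofK//.
by move: (b th) (b th') => y z; ring.
Qed.

End expfam_theory.

(** * Deviations of two arms *)

(** Log-likelihood ratio of parameter [ph] against the true one, for [N] samples with sum [s]. *)
Definition llr (R : realType) (F : expfam R) (mu : R) (N : nat) (ph s : R) : R :=
  s * (ph - theta_of F mu) - N%:R * (ef_b F ph - ef_b F (theta_of F mu)).

(* Restricting [ph] to one side of the true parameter makes this a ray, so
   its probability is the limit of Markov bounds at a single [ph]. *)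
Definition llr_tail (R : realType) (F : expfam R) (mu : R) (N : nat)
    (sg : bool) (y : R) : set R :=
  [set s | exists ph, [/\ ef_Theta F ph,
     0 <= (-1) ^+ sg * (ph - theta_of F mu) & y <= llr F mu N ph s]].

Section chernoff.
Context (R : realType) (F : expfam R) (n : nat) (mu : 'I_n -> R)
  (d : measure_display) (T : measurableType d) (P : probability T R)
  (X : 'I_n -> nat -> T -> R).
Hypothesis hmuM : forall i, ef_M F (mu i).
Hypothesis mX : forall i k, measurable_fun setT (X i k).
Hypothesis lawX : forall i k (A : set R), measurable A ->
  P (X i k @^-1` A) = (\int[ef_rho F]_(x in A) (ef_dens F (mu i) x)%:E)%E.
Hypothesis indX : mutually_independent P (fun ik : 'I_n * nat => X ik.1 ik.2).

Local Notation theta i := (theta_of F (mu i)).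
Local Notation Theta := (ef_Theta F).
Local Notation b := (ef_b F).

Let S i N w := \sum_(k < N) X i k w.

Let mS i N : measurable_fun setT (S i N).
Proof. by apply: measurable_sum => k. Qed.

Let thetaP i : Theta (theta i). Proof. exact: theta_of_mem. Qed.

(** A likelihood ratio has expectation 1 under the true law, sample by sample; independence
    multiplies the factors, and [i != k] keeps the two groups of samples disjoint. *)
Lemma integral_expR_llr (i k : 'I_n) (ph ph' : R) (N N' : nat) :
  i != k -> Theta ph -> Theta ph' ->
  (\int[P]_w (expR (llr F (mu i) N ph (S i N w) +
                    llr F (mu k) N' ph' (S k N' w)))%:E = 1)%E.
Proof.
move=> ik Tph Tph'.
pose psi j := if j == i then ph else if j == k then ph' else theta j.
have Tpsi j : Theta (psi j) by rewrite /psi; case: ifP => // _; case: ifP.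
have psii : psi i = ph by rewrite /psi eqxx.
have psik : psi k = ph' by rewrite /psi eq_sym (negbTE ik) eqxx.
pose f (jl : 'I_n * nat) x := expR (x * (psi jl.1 - theta jl.1)
                                  + - (b (psi jl.1) - b (theta jl.1))).
pose s := [seq (i, l) | l <- index_iota 0 N] ++ [seq (k, l) | l <- index_iota 0 N'].
have := @ge0_integral_prod_indep _ _ _ P _ (fun jl => X jl.1 jl.2) f (fun=> 1) s.
rewrite big1// => H; rewrite -H//.
- apply: eq_integral => w _; congr EFin; rewrite /s big_cat !big_map/=.
  rewrite -!expR_sum -expRD !big_mkord; congr expR.
  have aux j M a c : \sum_(l < M) (X j l w * a - c) = S j M w * a - M%:R * c.
    by rewrite big_split/= -mulr_suml sumr_const card_ord mulNrn mulr_natl.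
  by rewrite /f /= psii psik !aux.
- by move=> j; exact: measurable_expR_mul.
- by move=> j y; exact: expR_ge0.
- move=> [j l] /=.
  rewrite (ge0_integral_law (rho := ef_rho F) (g := ef_dens F (mu j))) //.
  + rewrite ef_densE.
    transitivity (\int[ef_rho F]_x ((expR (- (b (psi j) - b (theta j))))%:E *
       (expR (x * (psi j - theta j)) * ef_tilt F (theta j) x)%:E))%E.
      apply: eq_integral => x _; rewrite -EFinM; congr EFin.
      by rewrite /f /= expRD; ring.
    rewrite integralZl//; last exact: integrable_tilt_exp.
    by rewrite integral_tilt_exp// -EFinM -expRD addNr expR0.
  + exact: measurable_ef_tilt.
  + by move=> x; exact: expR_ge0.
  + by move=> A mA; exact: lawX.
  + exact: measurable_expR_mul.
  + by move=> y; exact: expR_ge0.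
- rewrite cat_uniq !map_inj_uniq ?iota_uniq; [|by move=> ? ? []..].
  rewrite andbT/=; apply/hasPn => -[j l] /mapP[l' _ [-> _]].
  by apply/negP => /mapP[l'' _ [/eqP]]; rewrite eq_sym (negbTE ik).
Qed.

Let measurable_ge (g : T -> R) (y : R) : measurable_fun setT g ->
  measurable [set w | y <= g w].
Proof.
move=> mg; rewrite (_ : [set _ | _] = g @^-1` `[y, +oo[%classic).
  by rewrite -[_ @^-1` _]setTI; exact: mg.
by apply/seteqP; split => w /=; rewrite in_itv/= andbT.
Qed.

Lemma measurable_llr i N ph :
  measurable_fun setT (fun w => llr F (mu i) N ph (S i N w)).
Proof. by apply: measurable_funB => //; apply: measurable_funM. Qed.

Lemma llr_markov (i k : 'I_n) (ph ph' : R) (N N' : nat) (y : R) :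
  i != k -> Theta ph -> Theta ph' ->
  (P [set w | (y <= llr F (mu i) N ph (S i N w) +
                    llr F (mu k) N' ph' (S k N' w))%R] <= (expR (- y))%:E)%E.
Proof.
move=> ik Tph Tph'; pose L w := llr F (mu i) N ph (S i N w) + llr F (mu k) N' ph' (S k N' w).
change (P [set w | (y <= L w)%R] <= (expR (- y))%:E)%E.
have mL : measurable_fun setT L by apply: measurable_funD; exact: measurable_llr.
have mA := measurable_ge y mL; set A := [set _ | _] in mA *.
have meL : measurable_fun setT (fun w => (expR (L w))%:E).
  by apply/measurable_EFinP; exact: measurableT_comp.
rewrite -[leRHS]mule1 -(integral_expR_llr N N' ik Tph Tph') -/L.
rewrite -ge0_integralZl//.
rewrite -[X in (P X <= _)%E]setIT -integral_indic//.
apply: ge0_le_integral => //.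
- by apply/measurable_EFinP; exact: measurable_indic.
- exact: measurable_funeM.
move=> w _; rewrite -EFinM lee_fin -expRD indicE.
case: (boolP (w \in A)) => [/[!inE] wA|_]; last exact: expR_ge0.
by rewrite -[1%:R](@expR0 R) ler_expR addrC subr_ge0.
Qed.

(** Each tail event says that a signed sum lies in a ray. With thresholds inside both rays, a single
    pair of parameters witnesses the whole event and Markov's inequality applies; the rays are then
    exhausted one after the other. *)
Lemma llr_tail_bound (i k : 'I_n) (N N' : nat) (sg sg' : bool) (y y' : R) :
  i != k ->
  let A := [set w | llr_tail F (mu i) N sg y (S i N w)] `&`
           [set w | llr_tail F (mu k) N' sg' y' (S k N' w)] in
  measurable A /\ (P A <= (expR (- (y + y')))%:E)%E.
Proof.
move=> ik.
have up j M s z t u : llr_tail F (mu j) M s z ((-1) ^+ s * t) -> t <= u ->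
    llr_tail F (mu j) M s z ((-1) ^+ s * u).
  move=> [ph [Tph ph0 zl]] tu; exists ph; split => //; apply: le_trans zl _.
  by rewrite lerD2r -mulrA -(mulrA _ u) mulrCA (mulrCA _ u) ler_wpM2r.
pose W j M s z : set R := [set t | llr_tail F (mu j) M s z ((-1) ^+ s * t)].
pose Y j M (s : bool) w := (-1) ^+ s * S j M w.
have mY j M s : measurable_fun setT (Y j M s) by exact: measurable_funM.
have WE j M s z : [set w | llr_tail F (mu j) M s z (S j M w)] =
    Y j M s @^-1` W j M s z.
  by apply/seteqP; split => w /=; rewrite /W /Y /= mulrA -expr2 sqrr_sign mul1r.
move=> A.
have {A}-> : A = (Y i N sg @^-1` W i N sg y) `&` (Y k N' sg' @^-1` W k N' sg' y').
  by congr (_ `&` _); exact: WE.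
have c0 : (0 <= (expR (- (y + y')))%:E)%E by rewrite lee_fin expR_ge0.
have step t : W i N sg y t ->
    (P ([set w | (t <= Y i N sg w)%R] `&` Y k N' sg' @^-1` W k N' sg' y')
      <= (expR (- (y + y')))%:E)%E.
  move=> Wt.
  have mYt : measurable [set w | t <= Y i N sg w] by exact: measurable_ge.
  have upW u v : W k N' sg' y' u -> u <= v -> W k N' sg' y' v by exact: up.
  apply: (proj2 (measure_upclosed_le mYt (mY k N' sg') c0 upW _)).
  move=> u Wu; have [ph [Tph ph0 yl]] := Wt; have [ph' [Tph' ph0' yl']] := Wu.
  apply: le_trans (llr_markov N N' (y + y') ik Tph Tph').
  apply: le_measure; rewrite ?inE.
  - by apply: measurableI; exact: measurable_ge.
  - by apply: measurable_ge; apply: measurable_funD; exact: measurable_llr.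
  move=> w [/= tw uw].
  (* On its side of the true parameter, [p] makes the ratio nondecreasing in the signed sum, so the
     witness for the threshold serves every larger sum. *)
  have mono j M (s : bool) z p v : 0 <= (-1) ^+ s * (p - theta j) ->
      z <= llr F (mu j) M p ((-1) ^+ s * v) -> v <= Y j M s w ->
      z <= llr F (mu j) M p (S j M w).
    move=> p0 zl vw; apply: le_trans zl _; rewrite lerD2r.
    have -> : S j M w = (-1) ^+ s * Y j M s w.
      by rewrite /Y mulrA -expr2 sqrr_sign mul1r.
    by rewrite -mulrA -(mulrA _ (Y _ _ _ _)) mulrCA (mulrCA _ (Y _ _ _ _)) ler_wpM2r.
  have H1 := mono _ _ _ _ _ _ ph0 yl tw.
  have H2 := mono _ _ _ _ _ _ ph0' yl' uw.
  exact: lerD H1 H2.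
(* Only measurability is wanted here, hence the trivial bound 1. *)
have mW : measurable (Y k N' sg' @^-1` W k N' sg' y').
  have [] := @measure_upclosed_le _ _ _ P setT (Y k N' sg') (W k N' sg' y') 1%E.
  - exact: measurableT.
  - exact: mY.
  - by [].
  - by move=> u v; exact: up.
  - move=> u _; apply: probability_le1; apply: measurableI => //.
    exact: measurable_ge.
  - by rewrite setTI.
rewrite setIC; apply: measure_upclosed_le => //.
- by move=> u v; exact: up.
- by move=> t Wt; rewrite setIC; exact: step.
Qed.

(** With both arms tilted to the midpoint, the ratios add up to [N * C] plus [(S k N - S i N) *
    (theta i - theta k) / 2], which is nonnegative on the event. *)
Lemma llr_mid_bound (i k : 'I_n) (N : nat) : theta k < theta i ->
  let A := [set w | S i N w <= S k N w] in
  let C := b (theta i) + b (theta k) - 2 * b ((theta i + theta k) / 2) in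
  measurable A /\ (P A <= (expR (- (N%:R * C)))%:E)%E.
Proof.
move=> ki A C.
have ik : i != k by apply/eqP => E; rewrite E ltxx in ki.
have mA : measurable A.
  have : measurable_fun setT (fun w => S k N w - S i N w) by exact: measurable_funB.
  move=> /(@measurable_ge _ 0); congr measurable.
  by apply/seteqP; split => w /=; rewrite subr_ge0.
split => //.
have Tm := Theta_mid (thetaP i) (thetaP k).
apply: le_trans (llr_markov N N (N%:R * C) ik Tm Tm).
apply: le_measure; rewrite ?inE//.
  by apply: measurable_ge; apply: measurable_funD; exact: measurable_llr.
move=> w; rewrite /A /= /llr /C => Sik.
move: (theta i) (theta k) ki Sik => u v; move: (S i N w) (S k N w) => a c uv ac.
have e1 : (u + v) / 2 - u = - ((u - v) / 2) by field.
have e2 : (u + v) / 2 - v = (u - v) / 2 by field.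
rewrite e1 e2 {e1 e2}; move: (b _) (b u) (b v) => m bu bv.
have uv0 : 0 <= (u - v) / 2 by rewrite divr_ge0// subr_ge0 ltW.
have ca0 : 0 <= c - a by rewrite subr_ge0.
rewrite -subr_ge0; have := mulr_ge0 ca0 uv0; congr (0 <= _).
by ring.
Qed.

End chernoff.

(** * The algorithm *)

(** If [pick] finds nothing, [best] returns the default [one] and the inequality is an equality. *)
Lemma best_ge n (one : 'I_n) (R : realType) (m : 'I_n -> R) :
  m one <= m (best one m).
Proof.
rewrite /best; case: pickP => //= i /andP[/forallP h _]; exact: h.
Qed.

Lemma natceilE (R : realType) (x : R) : 0 <= x -> (natceil x)%:Z = Num.ceil x.
Proof.
move=> x0; have c0 : (0 <= Num.ceil x)%R by rewrite ceil_ge0 (lt_le_trans _ x0)// ltrN10.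
by rewrite /natceil max_r// gez0_abs.
Qed.

Lemma le_natceil (R : realType) (x : R) : x <= (natceil x)%:R.
Proof.
apply: le_trans (ceil_ge x) _; rewrite -[(natceil x)%:R]/((natceil x)%:Z%:~R).
rewrite ler_int /natceil gez0_abs ?le_max ?lexx//.
by rewrite orbT.
Qed.

Lemma natceil_lt (R : realType) (x : R) : 0 <= x -> (natceil x)%:R < x + 1.
Proof.
move=> x0; rewrite -[(natceil x)%:R]/((natceil x)%:Z%:~R) natceilE//.
by rewrite -ltrBlDr; have := gt_pred_ceil x; rewrite rmorphB.
Qed.

Lemma leq_natceil (R : realType) (x y : R) : x <= y -> (natceil x <= natceil y)%N.
Proof.
move=> xy; have [x0|x0] := leP 0 x.
  by rewrite -lez_nat !natceilE ?(le_trans x0)//; exact: le_ceil.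
have c0 : (Num.ceil x <= 0)%R by rewrite ceil_le0 ltW.
by rewrite {1}/natceil max_l ?absz0.
Qed.

(** Topping up by a difference of ceilings keeps each count equal to the ceiling of the running
    maximum. *)
Lemma natceil_max (R : realType) (x y : R) : 0 <= x ->
  (natceil x + absz (Num.max 0%Z (Num.ceil y - Num.ceil x)%R))%N =
  natceil (Num.max x y).
Proof.
move=> x0; have mx0 : 0 <= Num.max x y by rewrite le_max x0.
apply: (can_inj absz_nat : injective Posz); rewrite PoszD !natceilE//.
have [yx|xy] := leP y x.
  by rewrite max_l ?absz0 ?addr0// subr_le0 le_ceil.
by rewrite max_r ?gez0_abs ?subrKC// subr_ge0 le_ceil// ltW.
Qed.

Section stage2.
Context (R : realType) (F : expfam R) (n : nat) (one : 'I_n)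
  (delta eps L1 L2 alpha : R) (X : 'I_n -> nat -> R).
Hypothesis L10 : 0 <= L1.

Let good (s : tri_state R n) := forall i,
  ts_N s i = natceil (ts_maxT s i) /\ L1 <= ts_maxT s i <= Num.max L1 L2.

Lemma stage2_step_pulls s : good s ->
  good (stage2_step F one delta eps L2 alpha X s).
Proof.
move=> gs; rewrite /stage2_step; case: ifP => // _ i /=.
have [-> /andP[Ll Lu]] := gs i; set t := (X in Num.ceil X).
(* In the invalid case the target is [L2] itself, the characteristic time being infinite there. *)
have tL : t <= L2 by rewrite /t; case: ifP => // _; rewrite ge_min lexx orbT.
split; first by rewrite natceil_max// (le_trans L10).
by rewrite le_max Ll/= ge_max Lu le_max tL orbT.
Qed.

Lemma stage2_pulls q :
  good (iter q (stage2_step F one delta eps L2 alpha X)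
    (TriState (fun _ => natceil L1) (fun _ => L1) (@uniformw R n) false)).
Proof.
elim: q => [|q IH] /=; last exact: stage2_step_pulls.
by move=> i /=; split => //; rewrite lexx le_max lexx.
Qed.

(** At a wrong stop in Stage III, arm [one] is among the rivals tested against [k]. In Stage IV all
    counts equal [natceil L3], since Stage II never exceeds it. *)
Lemma tri_bbai_error L3 beta :
  Num.max L1 L2 <= L3 ->
  tri_bbai F one delta eps L1 L2 L3 alpha beta X != one ->
  exists2 k, k != one &
    (exists N : 'I_n -> nat,
       [/\ forall i, (natceil L1 <= N i <= natceil (Num.max L1 L2))%N,
           emp_mean X N one <= emp_mean X N k &
           beta (\sum_i N i)%N (delta / 2) <= Zij F X N k one]) \/
    emp_mean X (fun=> natceil L3) one <= emp_mean X (fun=> natceil L3) k.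
Proof.
move=> LL3; rewrite /tri_bbai; set s := iter _ _ _.
have gs : good s by exact: stage2_pulls.
have bnd i : (natceil L1 <= ts_N s i <= natceil (Num.max L1 L2))%N.
  by have [-> /andP[Ll Lu]] := gs i; rewrite !leq_natceil.
set k := best one (emp_mean X (ts_N s)); case: ifPn => [/asboolP stop kone|_].
  exists k => //; left; exists (ts_N s); split => //; first exact: best_ge.
  by apply: stop; rewrite eq_sym.
have -> : (fun i => maxn (ts_N s i) (natceil L3)) = fun=> natceil L3.
  apply/funext => i; apply/maxn_idPr.
  by have /andP[_ /leq_trans] := bnd i; apply; exact: leq_natceil.
by move=> kone; eexists; [exact: kone|right; exact: best_ge].
Qed.

End stage2.

(** * From the stopping statistic to likelihood ratios against the truth *)

(** Algebra behind the Pythagorean identity: [u], [v], [tb] are the parameters of arm 1, arm [k] and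
    the pooled mean [mb]; [bu], [bv], [bt], [bm] are the log-partition values there and at the
    midpoint of [u] and [v]. The two sides differ by pooled divergences and a cross term that is
    nonnegative when the empirical order is wrong. *)
Lemma pooled_llr_gap (R : realFieldType)
    (N1 Nk m1 mk mb tb u v bt bu bv bm L p1 pk b1 bk : R) :
  0 <= L -> L <= N1 -> L <= Nk ->
  0 <= Nk * (mk - mb) -> N1 * (m1 - mb) = - (Nk * (mk - mb)) -> v <= u ->
  bt + (u - tb) * mb <= bu -> bt + (v - tb) * mb <= bv ->
  bt + ((u + v) / 2 - tb) * mb <= bm ->
  Nk * (mk * (pk - tb) - bk + bt) + N1 * (m1 * (p1 - tb) - b1 + bt) +
    L * (bu + bv - 2 * bm) <=
  N1 * m1 * (p1 - u) - N1 * (b1 - bu) + (Nk * mk * (pk - v) - Nk * (bk - bv)).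
Proof.
move=> L0 LN1 LNk c0 c1 vu t1 tk tm.
(* These are the divergences from the pooled member to the two true ones; the tangent at [tb], taken
   at the midpoint, bounds their sum below by [bu + bv - 2 * bm]. *)
pose D1 := mb * (tb - u) - bt + bu; pose Dk := mb * (tb - v) - bt + bv.
have D10 : 0 <= D1 by rewrite /D1; lra.
have Dk0 : 0 <= Dk by rewrite /Dk; lra.
have DC : bu + bv - 2 * bm <= D1 + Dk by rewrite /D1 /Dk; lra.
have LD : L * (bu + bv - 2 * bm) <= N1 * D1 + Nk * Dk.
  apply: le_trans (ler_wpM2l L0 DC) _; rewrite mulrDr.
  by apply: lerD; exact: ler_wpM2r.
have cuv : 0 <= Nk * (mk - mb) * (u - v) by rewrite mulr_ge0// subr_ge0.
have E : N1 * m1 * (p1 - u) - N1 * (b1 - bu) +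
    (Nk * mk * (pk - v) - Nk * (bk - bv)) -
    (Nk * (mk * (pk - tb) - bk + bt) + N1 * (m1 * (p1 - tb) - b1 + bt)) =
    N1 * D1 + Nk * Dk + N1 * (m1 - mb) * (tb - u) + Nk * (mk - mb) * (tb - v).
  by rewrite /D1 /Dk; ring.
have E2 : N1 * (m1 - mb) * (tb - u) + Nk * (mk - mb) * (tb - v) =
    Nk * (mk - mb) * (u - v) by rewrite c1; ring.
lra.
Qed.

(** Rounding the share of [a] down to an integer leaves finitely many ways to split [y], at the cost
    of 1. *)
Lemma floor_split (R : realType) (a c y : R) : 0 <= y -> y <= a + c ->
  exists m : nat, [/\ m%:R <= y, m%:R <= Num.max 0 a &
    y - 1 - m%:R <= Num.max 0 c].
Proof.
move=> y0 yac.
have a0 : 0 <= Num.max 0 a by rewrite le_max lexx.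
have c0 : 0 <= Num.max 0 c by rewrite le_max lexx.
have ac : y <= Num.max 0 a + Num.max 0 c.
  by apply: le_trans yac _; apply: lerD; rewrite le_max lexx orbT.
pose z := Num.min y (Num.max 0 a).
have z0 : 0 <= z by rewrite le_min y0.
have zy : z <= y by rewrite ge_min lexx.
have za : z <= Num.max 0 a by rewrite ge_min lexx orbT.
have zc : y - z <= Num.max 0 c.
  by rewrite /z; case: (leP y (Num.max 0 a)) => _; rewrite ?subrr//; lra.
pose m := Num.truncn z.
have mz : m%:R <= z by have /andP[] := truncn_itv z0.
have mz1 : z < m%:R + 1 by rewrite natr1; exact: truncnS_gt.
by exists m; split; [exact: le_trans mz zy|exact: le_trans mz za|lra].
Qed.

Section split.
Context (R : realType) (F : expfam R).
Local Notation b := (ef_b F).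
Local Notation theta := (theta_of F).

(* An empirical mean outside [ef_M F] contributes [kl = 0], which is the
   value of the right-hand side at the parameter of [m']. *)
Lemma kl_llr (m m' : R) : ef_M F m' -> exists2 ph, ef_Theta F ph &
  kl F m m' = m * (ph - theta m') - b ph + b (theta m').
Proof.
move=> Mm'; have [Mm|nMm] := pselect (ef_M F m).
  by exists (theta m); [exact: theta_of_mem|exact: klE].
exists (theta m'); first exact: theta_of_mem.
by rewrite /kl asboolF; [ring|case].
Qed.

(* The pooled mean [mb] projects the pair [(m1, mk)] onto the diagonal; when
   the order of the means is wrong, the log-likelihood ratio against the true
   means exceeds the statistic [Z] by the cost of the pooled mean. *)
Lemma Z_le_llr (mu1 muk m1 mk L : R) (N1 Nk : nat) :
  ef_M F mu1 -> ef_M F muk -> muk < mu1 -> m1 <= mk ->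
  0 <= L -> (0 < N1)%N -> (0 < Nk)%N -> L <= N1%:R -> L <= Nk%:R ->
  let mb := (Nk%:R * mk + N1%:R * m1) / (Nk%:R + N1%:R) in
  let Z := Nk%:R * kl F mk mb + N1%:R * kl F m1 mb in
  let C := b (theta mu1) + b (theta muk)
           - 2 * b ((theta mu1 + theta muk) / 2) in
  0 < Z ->
  exists ph1 phk, [/\ ef_Theta F ph1, ef_Theta F phk &
    Z + L * C <= llr F mu1 N1 ph1 (N1%:R * m1) + llr F muk Nk phk (Nk%:R * mk)].
Proof.
move=> M1 Mk lt1k le1k L0 N10 Nk0 LN1 LNk mb Z C Z0.
(* Outside the mean space both divergences take the conventional value 0, against [0 < Z]. *)
have Mb : ef_M F mb.
  apply: contrapT => nMb; move: Z0; rewrite /Z /kl !asboolF; [|by case..].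
  by rewrite !mulr0 addr0 ltxx.
have [phk Tphk klk] := kl_llr mk Mb; have [ph1 Tph1 kl1] := kl_llr m1 Mb.
exists ph1, phk; split => //.
have T1 := theta_of_mem M1; have Tk := theta_of_mem Mk.
have Tb := theta_of_mem Mb; have Tm := Theta_mid T1 Tk.
have lt1 := theta_of_lt Mk M1 lt1k.
have t1 := log_partition_tangent Tb T1.
have tk := log_partition_tangent Tb Tk.
have tm := log_partition_tangent Tb Tm.
move: t1 tk tm; rewrite theta_ofK// => t1 tk tm.
have N1R : 0 < N1%:R :> R by rewrite ltr0n.
have NkR : 0 < Nk%:R :> R by rewrite ltr0n.
have c1 : N1%:R * (m1 - mb) = - (Nk%:R * (mk - mb)).
  by rewrite /mb; field; rewrite gt_eqF// addr_gt0.
have c0 : 0 <= Nk%:R * (mk - mb).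
  have -> : Nk%:R * (mk - mb) = Nk%:R * N1%:R * (mk - m1) / (Nk%:R + N1%:R).
    by rewrite /mb; field; rewrite gt_eqF// addr_gt0.
  by rewrite divr_ge0// ?mulr_ge0// ?subr_ge0// addr_ge0.
by rewrite /Z klk kl1; exact: pooled_llr_gap (ltW lt1) t1 tk tm.
Qed.

(** The sign records the side of the true parameter on which [ph] lies; a level [y <= 0] is reached
    at the true parameter, where the ratio is 0. *)
Lemma llr_tailP (mu s y ph : R) (N : nat) : ef_M F mu -> ef_Theta F ph ->
  y <= Num.max 0 (llr F mu N ph s) -> exists sg, llr_tail F mu N sg y s.
Proof.
move=> Mmu Tph; have [l0|l0] := leP (llr F mu N ph s) 0 => yl.
  exists false, (theta mu); split; first exact: theta_of_mem.
    by rewrite subrr mulr0.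
  by apply: le_trans yl _; rewrite /llr !subrr !mulr0 subr0.
have [pt|tp] := leP (theta mu) ph.
  by exists false, ph; split => //; rewrite expr0 mul1r subr_ge0.
by exists true, ph; split => //; rewrite expr1 mulN1r oppr_ge0 subr_le0 ltW.
Qed.

Lemma llr_split (mu1 muk s1 sk y ph1 phk : R) (N1 Nk : nat) :
  ef_M F mu1 -> ef_M F muk -> ef_Theta F ph1 -> ef_Theta F phk -> 0 <= y ->
  y <= llr F mu1 N1 ph1 s1 + llr F muk Nk phk sk ->
  exists sg1 sgk (m : nat), [/\ m%:R <= y, llr_tail F mu1 N1 sg1 m%:R s1 &
    llr_tail F muk Nk sgk (y - 1 - m%:R) sk].
Proof.
move=> M1 Mk T1 Tk y0; set a := llr _ _ _ _ _; set c := llr _ _ _ _ _ => yac.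
have [m [my ma mc]] := floor_split y0 yac.
have [sg1 t1] := llr_tailP M1 T1 ma.
have [sgk tk] := llr_tailP Mk Tk mc.
by exists sg1, sgk, m; split; [exact: my|exact: t1|exact: tk].
Qed.

End split.

(** * The choice of [delta0] *)

Lemma exists_exp_dominates (R : realType) (A C : R) (p : nat) :
  0 <= A -> 0 < C ->
  exists s0 : R, forall s, s0 <= s -> 0 <= s -> A * s ^+ p <= expR (C * s).
Proof.
move=> A0 C0; have f0 : 0 < (p.+1)`!%:R :> R by rewrite ltr0n fact_gt0.
(* From here on the Taylor term of order [p + 1] alone exceeds [A * s ^+ p]. *)
exists (A * (p.+1)`!%:R / C ^+ p.+1) => s s0s s0.
have Cs0 : 0 <= C * s by rewrite mulr_ge0// ltW.
have := expR_ge1Dxn p Cs0; move: (p.+1)`!%:R f0 s0s => f f0 s0s.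
apply: le_trans; apply: (@le_trans _ _ ((C * s) ^+ p.+1 / f)); last by rewrite lerDr.
rewrite ler_pdivlMr// exprMn mulrAC [s ^+ p.+1]exprS mulrA.
rewrite ler_wpM2r ?exprn_ge0//.
by rewrite [leRHS]mulrC -ler_pdivrMr ?exprn_gt0.
Qed.

Lemma ln_le_id (R : realType) (x : R) : 0 < x -> ln x <= x.
Proof.
move=> x0; have := expR_ge1Dx (ln x); rewrite lnK ?posrE//; lra.
Qed.

(** The factors [ln (2 / delta)] and [t ^ alpha] are at least 1, and [2 / delta] exceeds
    [1 / delta]. *)
Lemma ln_threshold_ge (R : realType) (alpha delta : R) (t : nat) :
  0 <= alpha -> 0 < delta -> 1 <= ln delta^-1 -> (0 < t)%N ->
  ln delta^-1 <= ln (ln (delta / 2)^-1 * (t%:R `^ alpha) / (delta / 2)).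
Proof.
move=> a0 d0 l1 t0.
have d20 : 0 < delta / 2 by lra.
have di0 : 0 < delta^-1 by rewrite invr_gt0.
have E : (delta / 2)^-1 = 2 * delta^-1 by rewrite invf_div.
have l2 : 1 <= ln (delta / 2)^-1.
  apply: le_trans l1 _; rewrite ler_ln ?posrE ?invr_gt0// E.
  by rewrite ler_peMl ?ler1n// ltW.
have p1 : 1 <= t%:R `^ alpha.
  rewrite -[leLHS](powRr0 (t%:R : R)); apply: ler_powR => //.
  by rewrite ler1n.
have q1 : 1 <= ln (delta / 2)^-1 * t%:R `^ alpha by rewrite -[leLHS]mulr1 ler_pM.
have q0 : 0 < ln (delta / 2)^-1 * t%:R `^ alpha / (delta / 2).
  by rewrite divr_gt0// (lt_le_trans ltr01).
have d2 : delta^-1 <= 2 * delta^-1 by lra.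
rewrite ler_ln ?posrE//; rewrite E in q1 *; rewrite -[leLHS]mul1r.
by apply: ler_pM q1 d2 => //; exact: ltW.
Qed.

(** Here [s] stands for the square root of [l = log (1/delta)], and [K] caps the Stage II counts.
    The conclusions place that cap below [L3], fit Stage IV under the common bound, and close the
    union bound: per arm, two counts, two signs and a level, plus one Stage IV event. *)
Lemma batch_numerics (R : realType) (n : nat) (C : R) : (0 < n)%N -> 0 < C ->
  exists2 s0 : R, 1 <= s0 & forall s, s0 <= s ->
  let l := s ^+ 2 in
  let K := natceil (Num.max s (l * ln l / n%:R)) in
  let y := l + s * C in
  [/\ Num.max s (l * ln l / n%:R) <= l ^+ 2,
      expR (- ((natceil (l ^+ 2))%:R * C)) <= expR (- (y - 1)) &
      expR (- (y - 1)) * (n * (K.+1 * K.+1 * 2 * 2 * (Num.truncn y).+1 + 1))%:R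
        <= expR (- l)].
Proof.
move=> n0 C0; have n1 : 1 <= n%:R :> R by rewrite ler1n.
(* The count is at most [n * (36 * (2 + C) + 1) * s ^+ 10], from [K + 1 <= 3 * s ^+ 4] twice, four
   sign pairs and at most [(2 + C) * s ^+ 2] levels; [expR 1] pays for the rounding loss. *)
pose A : R := expR 1 * (n%:R * (36 * (2 + C) + 1)).
have A0 : 0 <= A.
  apply: mulr_ge0; first exact: expR_ge0.
  by apply: mulr_ge0 => //; lra.
have [s1 Hs1] := exists_exp_dominates 10 A0 C0.
exists (Num.max s1 (2 + 2 / C)).
  rewrite le_max; apply/orP; right.
  have : 0 <= 2 / C by rewrite divr_ge0// ltW.
  by lra.
move=> s; rewrite ge_max => /andP[s1s s2s] l K y.
have C20 : 0 <= 2 / C by rewrite divr_ge0// ltW.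
have s2 : 2 <= s by lra.
have sC : 2 <= s * C by rewrite -ler_pdivrMr//; lra.
have s0 : 0 < s by lra.
have l4 : 4 <= l by rewrite /l expr2; nra.
have sl : s <= l by rewrite /l expr2; nra.
have ll : l <= l ^+ 2 by rewrite expr2; nra.
have l0 : 0 < l by lra.
have max_l : Num.max s (l * ln l / n%:R) <= l ^+ 2.
  rewrite ge_max (le_trans sl ll)/= ler_pdivrMr ?ltr0n//.
  have := ln_le_id l0; have l2 : 0 <= l ^+ 2 by lra.
  move: (ln l) => z zl; apply: (@le_trans _ _ (l ^+ 2)); last by nra.
  by rewrite expr2 ler_wpM2l// ltW.
have Kl : (K.+1)%:R <= 3 * l ^+ 2.
  have : K%:R < Num.max s (l * ln l / n%:R) + 1.
    by apply: natceil_lt; rewrite le_max ltW.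
  by rewrite -natr1; lra.
have y0 : 0 <= y by rewrite /y; nra.
have My : (Num.truncn y).+1%:R <= (2 + C) * l.
  have /andP[h _] := truncn_itv y0.
  by rewrite -natr1; move: h; rewrite /y; nra.
split => //.
- rewrite ler_expR lerN2; have := le_natceil (l ^+ 2).
  move: (natceil _)%:R => z zl.
  apply: (@le_trans _ _ (l ^+ 2 * C)); last by rewrite ler_wpM2r// ltW.
  have h1 : 2 * s * l <= l ^+ 2 * C.
    have -> : l ^+ 2 * C = (s * C) * s * l by rewrite /l; ring.
    by rewrite ler_wpM2r ?(ltW l0)// ler_wpM2r// ltW.
  have h2 : 2 * (s * C) <= l ^+ 2 * C.
    rewrite mulrA ler_wpM2r ?(ltW C0)//; nra.
  have h3 : l <= s * l by rewrite ler_peMl ?(ltW l0)//; lra.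
  rewrite /y; lra.
have s8 : (1 : R) <= s ^+ 10 by rewrite exprn_ege1//; lra.
have Hcount : (n * (K.+1 * K.+1 * 2 * 2 * (Num.truncn y).+1 + 1))%:R <=
    n%:R * (36 * (2 + C) + 1) * s ^+ 10.
  rewrite natrM -mulrA ler_wpM2l// natrD !natrM.
  move: (K.+1)%:R (Num.truncn y).+1%:R Kl My (ler0n R K.+1)
    (ler0n R (Num.truncn y).+1) => k m kl ml k0 m0.
  rewrite mulrDl mul1r; apply: lerD => //.
  have -> : 36 * (2 + C) * s ^+ 10 =
      (3 * l ^+ 2) * (3 * l ^+ 2) * 2 * 2 * ((2 + C) * l) by rewrite /l; ring.
  by do 4 (apply: ler_pM => //; rewrite ?mulr_ge0//).
have := Hs1 s s1s (ltW s0).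
(* The factor [exp (- C * s)] absorbs the polynomial count and leaves [exp (- l)]. *)
have -> : - (y - 1) = 1 + (- (C * s) + - l) by rewrite /y; ring.
rewrite !expRD (expRN (C * s)); move: Hcount; rewrite /A.
move: (_%:R) (n%:R * _) (expR_gt0 (1 : R)) (expR_gt0 (C * s)) (expR_gt0 (- l)).
move: (expR 1) (expR (C * s)) (expR (- l)) => e E el c B e0 E0 el0 cB HA.
have -> : e * (E^-1 * el) * c = el * (e * c / E) by ring.
rewrite ler_piMr ?(ltW el0)// ler_pdivrMr// mul1r; apply: le_trans HA.
by rewrite -mulrA ler_wpM2l// ltW.
Qed.

Lemma emp_meanK (R : realType) (n : nat) (X : 'I_n -> nat -> R)
    (N : 'I_n -> nat) (i : 'I_n) : (0 < N i)%N ->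
  (N i)%:R * emp_mean X N i = \sum_(k < N i) X i k.
Proof. by move=> N0; rewrite /emp_mean mulrC divfK// pnatr_eq0 -lt0n. Qed.

Lemma mem_bigsetU_fin (J : finType) (T : Type) (G : J -> set T) (j : J) (w : T) :
  G j w -> (\big[setU/set0]_i G i) w.
Proof. by move=> Gw; rewrite (bigD1 j)//=; left. Qed.

(** * The union bound over deterministic sample sizes *)

Unset Implicit Arguments.
Set Strict Implicit.

Theorem mainTheorem2 (R : realType) (F : expfam R) (n : nat) (hn : (2 <= n)%N)
  (one : 'I_n) (hone : val one = 0%N)
  (mu : 'I_n -> R) (hmuM : forall i, ef_M F (mu i))
  (hmu12 : forall j : 'I_n, val j = 1%N -> mu j < mu one)
  (hmusort : forall i j : 'I_n, (1 <= val i)%N -> (val i <= val j)%N -> mu j <= mu i)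
  (alpha : R) (halpha : 1 < alpha <= expR 1 / 2) :
  exists delta0 : R, 0 < delta0 < 1 /\
  forall delta : R, 0 < delta < delta0 ->
  let eps := (ln (ln delta^-1))^-1 in
  let L1 := Num.sqrt (ln delta^-1) in
  let L2 := ln delta^-1 * ln (ln delta^-1) / n%:R in
  let L3 := (ln delta^-1) ^+ 2 in
  let beta := fun (t : nat) (del : R) => ln (ln del^-1 * (t%:R `^ alpha) / del) in
  forall (d : measure_display) (T : measurableType d) (P : probability T R)
         (X : 'I_n -> nat -> T -> R),
    (forall i k, measurable_fun setT (X i k)) ->
    (* X i k has law nu_{mu_i} : density ef_dens F (mu i) w.r.t. rho *)
    (forall i k (A : set R), measurable A ->
       P (X i k @^-1` A) = (\int[ef_rho F]_(x in A) (ef_dens F (mu i) x)%:E)%E) ->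
    mutually_independent P (fun ik : 'I_n * nat => X ik.1 ik.2) ->
    exists E : set T, measurable E /\
      [set w | tri_bbai F one delta eps L1 L2 L3 alpha beta
                 (fun i k => X i k w) != one] `<=` E /\
      (P E <= delta%:E)%E.
Proof.
pose theta i := theta_of F (mu i).
pose Ck k := ef_b F (theta one) + ef_b F (theta k)
             - 2 * ef_b F ((theta one + theta k) / 2).
have mu_lt k : k != one -> mu k < mu one.
  move=> kone; have k1 : (1 <= val k)%N.
    by rewrite lt0n; apply: contra kone => /eqP k0; apply/eqP/val_inj; rewrite k0.
  exact: le_lt_trans (hmusort (Ordinal hn) k (leqnn 1) k1)
    (hmu12 (Ordinal hn) erefl).
have theta_lt k : k != one -> theta k < theta one.
  by move=> /mu_lt; exact: theta_of_lt.
(* One positive constant below every gap; the initial value 1 merely caps it. *)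
pose C := \big[Num.min/(1 : R)]_(k | k != one) Ck k.
have C0 : 0 < C.
  apply: (big_ind (fun x : R => 0 < x)) => //.
    by move=> x y x0 y0; rewrite lt_min x0.
  move=> k kone; rewrite subr_gt0; apply: log_partition_mid_lt.
  - exact: theta_of_mem.
  - exact: theta_of_mem.
  - by rewrite gt_eqF// theta_lt.
have CCk k : k != one -> C <= Ck k.
  by move=> kone; rewrite /C (bigD1 k)//= ge_min lexx.
have n0 : (0 < n)%N by exact: leq_trans hn.
have [s0 s01 Hs0] := batch_numerics n0 C0.
(* Chosen so that [delta < delta0] means [s0 ^+ 2 < log (1/delta)]. *)
exists (expR (- (s0 ^+ 2))); split.
  rewrite expR_gt0/= expR_lt1 oppr_lt0 exprn_gt0//; exact: lt_le_trans s01.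
move=> delta /andP[d0 dlt] eps L1 L2 L3 beta d T P X mX lawX indX.
have s0l : s0 ^+ 2 < ln delta^-1.
  by rewrite lnV ?posrE// ltrNr -ltr_expR lnK.
have l1 : 1 <= ln delta^-1.
  by apply: le_trans (ltW s0l); rewrite exprn_ege1.
have s0s : s0 <= L1.
  rewrite -(ger0_norm (le_trans ler01 s01)) -sqrtr_sqr ler_sqrt//; first exact: ltW.
  exact: le_trans l1.
have lE : L1 ^+ 2 = ln delta^-1 by rewrite sqr_sqrtr// (le_trans _ l1).
have := Hs0 L1 s0s; rewrite lE -/L2 -/L3 => -[maxL expL3 countJ].
move: countJ expL3; set K := natceil (Num.max L1 L2).
set y := ln delta^-1 + L1 * C; set M := Num.truncn y => countJ expL3.
have L10 : 0 < L1 by apply: lt_le_trans s0s; exact: lt_le_trans s01.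
have cL1 : (0 < natceil L1)%N.
  by rewrite -(ltr_nat R); exact: lt_le_trans L10 (le_natceil L1).
have cL3 : (0 < natceil L3)%N.
  rewrite -(ltr_nat R); apply: lt_le_trans (le_natceil L3).
  by apply: lt_le_trans maxL; rewrite lt_max L10.
have y0 : 0 <= y.
  by apply: addr_ge0; [exact: le_trans l1|apply: mulr_ge0; exact: ltW].
pose S i N w := \sum_(k < N) X i k w.
pose J : finType :=
  ('I_n * (('I_K.+1 * 'I_K.+1 * bool * bool * 'I_M.+1) + unit))%type.
(* The index ranges over all arms, so arm [one] gets the empty event; [inl] covers Stage III and
   [inr] Stage IV. *)
pose G (j : J) : set T := if j.1 == one then set0 else
  match j.2 with
  | inl (N1, Nk, sg1, sgk, m) =>
      [set w | llr_tail F (mu one) N1 sg1 (m : nat)%:R (S one N1 w)] `&`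
      [set w | llr_tail F (mu j.1) Nk sgk (y - 1 - (m : nat)%:R) (S j.1 Nk w)]
  | inr _ => [set w | S one (natceil L3) w <= S j.1 (natceil L3) w]
  end.
have HG j : measurable (G j) /\ (P (G j) <= (expR (- (y - 1)))%:E)%E.
  rewrite /G; have [_|kone] := eqVneq j.1 one.
    by split => //; rewrite measure0 lee_fin expR_ge0.
  case: j.2 => [[[[[N1 Nk] sg1] sgk] m]|_].
    have ik : one != j.1 by rewrite eq_sym.
    (* The two levels always add up to [y - 1], which makes the bound uniform in the index. *)
    have := @llr_tail_bound R F n mu d T P X hmuM mX lawX indX one j.1 N1 Nk
      sg1 sgk (m : nat)%:R (y - 1 - (m : nat)%:R) ik.
    by rewrite /= subrKC.
  have [mA PA] := @llr_mid_bound R F n mu d T P X hmuM mX lawX indX one j.1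
    (natceil L3) (theta_lt _ kone).
  split; first exact: mA.
  apply: (le_trans PA); rewrite lee_fin; apply: le_trans expL3.
  by rewrite ler_expR lerN2 ler_wpM2l//; exact: CCk.
have [mE PE] := measure_bigcup_fin_le HG.
exists (\big[setU/set0]_j G j); split => //; split; last first.
  apply: (le_trans PE); rewrite lee_fin.
  have -> : delta = expR (- ln delta^-1) by rewrite lnV ?posrE// opprK lnK.
  rewrite -mulr_natr !(card_prod, card_sum) !card_ord !card_bool card_unit.
  exact: countJ.
move=> w /= err.
have [k kone err_k] := tri_bbai_error (ltW L10) maxL err.
case: err_k => [[N [Nbnd le1k stop]]|le1k]; last first.
  apply: (@mem_bigsetU_fin J _ G (k, inr tt)); rewrite /G /= (negbTE kone) /S.
  have cR : 0 <= (natceil L3)%:R :> R by [].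
  have := ler_wpM2l cR le1k.
  by rewrite (@emp_meanK _ _ _ (fun=> natceil L3) one cL3)
    (@emp_meanK _ _ _ (fun=> natceil L3) k cL3).
have N0 i : (0 < N i)%N by have /andP[h _] := Nbnd i; exact: leq_trans h.
have LN i : L1 <= (N i)%:R.
  by have /andP[h _] := Nbnd i; apply: le_trans (le_natceil L1) _; rewrite ler_nat.
have NK i : (N i < K.+1)%N by have /andP[_ h] := Nbnd i; rewrite ltnS.
have a0 : 0 <= alpha by case/andP: halpha => a1 _; exact: le_trans (ltW a1).
have lZ : ln delta^-1 <= Zij F (fun i k => X i k w) N k one.
  apply: le_trans stop; apply: ln_threshold_ge => //.
  by rewrite (bigD1 one)//= addn_gt0 N0.
have Z0 : 0 < Zij F (fun i k => X i k w) N k one.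
  by apply: lt_le_trans lZ; exact: lt_le_trans l1.
have [ph1 [phk [T1 Tk Zle]]] := Z_le_llr (hmuM one) (hmuM k) (mu_lt _ kone)
  le1k (ltW L10) (N0 one) (N0 k) (LN one) (LN k) Z0.
have SE i : S i (N i) w = (N i)%:R * emp_mean (fun i k => X i k w) N i.
  by rewrite emp_meanK.
(* The threshold supplies [log (1/delta)] and the pooled cost supplies [L1 * C]. *)
have yle : y <= llr F (mu one) (N one) ph1 (S one (N one) w) +
    llr F (mu k) (N k) phk (S k (N k) w).
  rewrite !SE; refine (le_trans _ Zle).
  have CkL : L1 * C <= L1 * Ck k by apply: ler_wpM2l; [exact: ltW|exact: CCk].
  exact: (lerD lZ CkL).
have [sg1 [sgk [m [my t1 tk]]]] := llr_split (hmuM one) (hmuM k) T1 Tk y0 yle.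
have mM : (m < M.+1)%N by rewrite ltnS truncn_ge_nat.
apply: (@mem_bigsetU_fin J _ G
  (k, inl (Ordinal (NK one), Ordinal (NK k), sg1, sgk, Ordinal mM))).
by rewrite /G /= (negbTE kone); split; [exact: t1|exact: tk].
Qed.
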